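(* Let $k\ge 0$ be an integer. Suppose that $(Z_t)_{t\in\mathbb{N}}$ are i.i.d. real random variables with $E|Z_1|^{2k+\gamma}<\infty$ for some $\gamma>0$, and let the weight function be $w(u)=(\log(e+|u|))^{-1/2-\delta}$, $u\in\mathbb{R}$, for some $\delta>0$. Then $$\sup_{n\ge 1}E\,\|C_n^{(k)}\|_{L_\infty(w)}<\infty .$$
   Context: The normalized characteristic function process is $$C_n(u)=n^{-1/2}\sum_{t=1}^n\big(e^{iuZ_t}-E[e^{iuZ_1}]\big),\qquad u\in\mathbb{R},$$ $C_n^{(k)}$ denotes its $k$-th derivative in $u$ (with $C_n^{(0)}=C_n$), which exists if $E|Z_1|^k<\infty$, and $$\|C_n^{(k)}\|_{L_\infty(w)}=\sup_{u\in\mathbb{R}}\big\{|C_n^{(k)}(u)|\,w(u)\big\}.$$ *)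

(* Defs.v *)
From HB Require Import structures.
From mathcomp Require Import all_boot all_order all_algebra.
From mathcomp Require Import finmap.
From mathcomp Require Import all_classical all_reals all_analysis.
From mathcomp Require Import complex.

Set Implicit Arguments.
Unset Strict Implicit.
Unset Printing Implicit Defensive.

Import Order.TTheory GRing.Theory Num.Theory.
Import numFieldNormedType.Exports.

Local Open Scope classical_set_scope.
Local Open Scope ring_scope.
Local Open Scope complex_scope.

(* [Rcomplex R] is an alias of the field [R[i]] that carries an [R]-module
   structure and the real-valued modulus.  We equip it with the topology of the
   modulus, so that [derive1n] applies to functions [R -> Rcomplex R]. *)
Lemma Rcomplex_normrZ (R : rcfType) (a : R) (z : Rcomplex R) :
  `|a *: z| = `|a| * `|z|.
Proof.
case: z => x y.
by rewrite /Num.norm /= !exprMn -mulrDr sqrtrM ?sqr_ge0// sqrtr_sqr.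
Qed.

HB.instance Definition _ (R : rcfType) :=
  PseudoMetric.copy (Rcomplex R) (pseudoMetric_normed (Rcomplex R)).
HB.instance Definition _ (R : rcfType) := isPointed.Build (Rcomplex R) 0.
HB.instance Definition _ (R : rcfType) :=
  NormedZmod_PseudoMetric_eq.Build R (Rcomplex R) erefl.
HB.instance Definition _ (R : rcfType) :=
  PseudoMetricNormedZmod_Lmodule_isNormedModule.Build R (Rcomplex R)
    (@Rcomplex_normrZ R).

(* [expi x] is e^{i x}, by Euler's formula. *)
Definition expi (R : realType) (x : R) : Rcomplex R := cos x +i* sin x.

(* Used only for bounded [X], for which both expectations are finite. *)
Definition Cexpectation (d : measure_display) (T : measurableType d)
    (R : realType) (P : probability T R) (X : T -> Rcomplex R) : Rcomplex R :=
  fine 'E_P[fun x => complex.Re (X x)] +i* fine 'E_P[fun x => complex.Im (X x)].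

Definition mutually_independent (d : measure_display) (T : measurableType d)
    (R : realType) (P : probability T R) (I : choiceType) (D : set I)
    (Z : I -> {RV P >-> R}) : Prop :=
  forall J : {fset I}, [set` J] `<=` D ->
  forall B : I -> set R, (forall i, measurable (B i)) ->
    P (\bigcap_(i in [set` J]) (Z i @^-1` B i)) =
    (\prod_(i <- J) P (Z i @^-1` B i))%E.

Definition identically_distributed (d : measure_display)
    (T : measurableType d) (R : realType) (P : probability T R)
    (I : choiceType) (D : set I) (Z : I -> {RV P >-> R}) : Prop :=
  forall i j, D i -> D j -> forall B : set R, measurable B ->
    distribution P (Z i) B = distribution P (Z j) B.

Arguments mutually_independent {d T R} P {I}.
Arguments identically_distributed {d T R} P {I}.

(* The sequence is Z_1, Z_2, ...: nothing is required of [Z 0]. *)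
Definition iid (d : measure_display) (T : measurableType d) (R : realType)
    (P : probability T R) (Z : nat -> {RV P >-> R}) : Prop :=
  mutually_independent P [set t | (1 <= t)%N] Z /\
  identically_distributed P [set t | (1 <= t)%N] Z.

Arguments iid {d T R} P.

Definition char_process (d : measure_display) (T : measurableType d)
    (R : realType) (P : probability T R) (Z : nat -> {RV P >-> R})
    (n : nat) (x : T) (u : R) : Rcomplex R :=
  (n%:R `^ (- 2^-1)) *:
  \sum_(1 <= t < n.+1)
    (expi (u * Z t x) - Cexpectation P (fun y => expi (u * Z 1%N y))).

Arguments char_process {d T R} P.

Definition weight (R : realType) (delta : R) (u : R) : R :=
  ln (expR 1 + `|u|) `^ (- 2^-1 - delta).

Definition weighted_sup_norm (R : realType) (w : R -> R)
    (f : R -> Rcomplex R) : \bar R :=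
  ereal_sup [set (`|f u| * w u)%:E | u in [set: R]].

(* Main.v *)
Require Import Defs.
From HB Require Import structures.
From mathcomp Require Import all_boot all_order all_algebra.
From mathcomp Require Import finmap.
From mathcomp Require Import all_classical all_reals all_analysis.
From mathcomp Require Import measurable_realfun.
From mathcomp Require Import complex.
From mathcomp Require Import ring lra.

Set Implicit Arguments.
Unset Strict Implicit.
Unset Printing Implicit Defensive.

Import Order.TTheory GRing.Theory Num.Theory.
Import numFieldNormedType.Exports.

Local Open Scope classical_set_scope.
Local Open Scope ring_scope.

(** Write G_n(g) for the empirical process n^(-1/2) sum_t (g(Z_t) - E g(Z_1)).
    Differentiating k times, under the expectation as well, turns the real and
    imaginary parts of C_n^(k)(u) into G_n(f_u) with
    f_u(z) = z^k cos(u z + phase) for two phases.  So it is enough to bound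
    E sup_u w(u) |G_n(f_u)| uniformly in n for such a family.  Only two facts
    about the family matter: an envelope |f_u| <= F with F = |z|^k, and a
    Hoelder condition |f_u - f_v| <= |u - v|^alpha H with
    H = 2 |z|^(k + alpha), where alpha = min(1, gamma / 2); both F and H are
    square integrable because 2k + 2 alpha <= 2k + gamma.

    The probabilistic input is [expectation_max_emp]: if N functions have a
    common envelope F with E F(Z_1)^2 <= V, and N <= e^L with L >= 1, then the
    expectation of the largest |G_n(f_i)| is at most (3 + 6V) sqrt L, for
    every n.
    Truncate at the level tau = sqrt(n/L)/2.  The tails are at most F^2/tau,
    so a crude triangle inequality, which loses a factor sqrt n, costs
    4V sqrt L.  The truncated functions are small enough for the
    moment generating function of G_n at +- sqrt L to be at most e^(2LV)
    ([emp_mgf]), and summing these exponentials over the family bounds the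
    maximum.  The choice of tau balances the two contributions, so two
    moments of the envelope are enough.

    The supremum over all real u is then reached by chaining along the scales
    M_l = 2^(2^l).  The grid of mesh 1/M_l on [-M_l, M_l] has at most
    e^(4 2^l) points, so both the range and the mesh are governed by the
    single number 2^l.  If M_l0 is the first scale that reaches |u|, then G_n(f_u)
    is its value at a grid point of level l0 plus the increments between the
    successive levels.  The grid value costs sqrt(2^l0), and the weight
    w(u), at most of order (2^l0)^(-1/2-delta), turns it into a convergent geometric
    series in l0.  The increments at level l have envelope (2/M_l)^alpha H,
    and M_l^(-alpha) beats sqrt(2^l), so they are summable without the weight.
    The chain is stopped at l = n, where mesh and weight are so small that
    the crude bound is enough for what remains ([weighted_chaining]).

    All bounds on suprema have the form of one measurable function D dominating
    everything pointwise, with a bound on its expectation ([mean_bound]);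
    no supremum has to be shown measurable. *)

(** * Integrals and independence *)

Section integral_prelim.
Context {d : measure_display} {T : measurableType d} {R : realType}.
Variable mu : {measure set T -> \bar R}.

(** For nonnegative functions the integral is a supremum over simple functions
    below, hence monotone without measurability.  This is what allows a
    supremum over uncountably many u under the integral sign. *)
Lemma ge0_le_integral_nomeas (f g : T -> \bar R) :
  (forall x, 0 <= f x)%E -> (forall x, f x <= g x)%E ->
  (\int[mu]_x f x <= \int[mu]_x g x)%E.
Proof.
move=> f0 fg; have g0 x : (0 <= g x)%E by exact: le_trans (f0 x) (fg x).
rewrite !ge0_integralTE//; apply: le_ereal_sup => _ [h /= hf <-].
by exists h => // x; exact: le_trans (hf x) (fg x).
Qed.

Import HBNNSimple.

(** Factorization of an expectation passes from events to functions of [X]: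
    both sides are measures in [B], so they agree on simple functions of [X]
    and, by monotone convergence, on nonnegative ones. *)
Lemma ge0_integral_factor (W : T -> R) (X : {mfun T >-> R}) (c : R) :
  (forall x, 0 <= W x) -> measurable_fun setT W -> 0 <= c ->
  (forall B : set R, measurable B ->
    \int[mu]_x (W x * \1_B (X x))%:E = c%:E * mu (X @^-1` B))%E ->
  forall h : R -> R, measurable_fun setT h -> (forall z, 0 <= h z) ->
  (\int[mu]_x (W x * h (X x))%:E = c%:E * \int[mu]_x (h (X x))%:E)%E.
Proof.
move=> W0 mW c0 Wind h mh h0.
have /measurable_EFinP mhE := mh.
have mX : measurable_fun setT X by [].
pose f_ := nnsfun_approx measurableT mhE.
have f_cvg z : (f_ n z)%:E @[n --> \oo] --> (h z)%:E.
  by apply: (cvg_nnsfun_approx measurableT mhE) => // y _; rewrite lee_fin.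
have f_nd z : {homo (fun n => f_ n z) : m n / (m <= n)%N >-> m <= n}.
  by move=> m n mn; exact/lefP/nd_nnsfun_approx.
have mfX n : measurable_fun setT (fun x => f_ n (X x)).
  exact: measurableT_comp.
have -> : (\int[mu]_x (W x * h (X x))%:E =
    limn (fun n => \int[mu]_x (W x * f_ n (X x))%:E))%E.
  rewrite -monotone_convergence//; last 3 first.
  - by move=> n; apply/measurable_EFinP; exact: measurable_funM.
  - by move=> n x _; rewrite lee_fin mulr_ge0.
  - by move=> x _ m n mn; rewrite lee_fin ler_wpM2l// f_nd.
  apply: eq_integral => x _; apply/esym/cvg_lim => //.
  under eq_fun do rewrite EFinM.
  by rewrite EFinM; apply: cvgeZl => //; exact: f_cvg.
have -> : (\int[mu]_x (h (X x))%:E =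
    limn (fun n => \int[mu]_x (f_ n (X x))%:E))%E.
  rewrite -monotone_convergence//; last 3 first.
  - by move=> n; apply/measurable_EFinP.
  - by move=> n x _; rewrite lee_fin.
  - by move=> x _ m n mn; rewrite lee_fin f_nd.
  by apply: eq_integral => x _; apply/esym/cvg_lim => //; exact: f_cvg.
rewrite -limeMl//; last first.
  apply: ereal_nondecreasing_is_cvgn => m n mn; apply: ge0_le_integral => //.
  - by move=> x _; rewrite lee_fin.
  - exact/measurable_EFinP.
  - exact/measurable_EFinP.
  - by move=> x _; rewrite lee_fin f_nd.
congr (limn _); apply/funext => n.
have mpre r : measurable (f_ n @^-1` [set r]) by [].
have mi r : measurable_fun setT (fun x => \1_(f_ n @^-1` [set r]) (X x) : R).
  by apply: measurableT_comp mX; exact: measurable_indic.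
transitivity (\sum_(k \in range (f_ n))
    \int[mu]_x (k * (W x * \1_(f_ n @^-1` [set k]) (X x)))%:E)%E.
  rewrite -ge0_integral_fsum//; last 2 first.
  - by move=> r; apply/measurable_EFinP; do 2 apply: measurable_funM => //.
  - move=> r x _; rewrite lee_fin mulrCA mulr_ge0//.
    exact: nnfun_muleindic_ge0.
  apply: eq_integral => x _; rewrite fsumEFin// fimfunE; congr EFin.
  rewrite mulr_fsumr//.
  by apply: eq_fsbigr => r _; rewrite mulrCA.
transitivity (\sum_(k \in range (f_ n))
    (c%:E * \int[mu]_x (k * (\1_(f_ n @^-1` [set k]) (X x)))%:E))%E.
  apply: eq_fsbigr => r; rewrite inE => -[z _ <-].
  under eq_integral do rewrite EFinM.
  rewrite ge0_integralZl_EFin//; last 2 first.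
  - by move=> x _; rewrite lee_fin mulr_ge0.
  - by apply/measurable_EFinP; exact: measurable_funM.
  rewrite Wind//.
  under [in RHS]eq_integral do rewrite EFinM.
  rewrite ge0_integralZl_EFin//; last exact/measurable_EFinP.
  rewrite muleCA; congr (_ * (_ * _))%E.
  have mA : measurable (X @^-1` (f_ n @^-1` [set f_ n z])).
    by rewrite -[X in measurable X]setTI; exact: mX.
  by rewrite -[in LHS](setIT (X @^-1` _)) -integral_indic.
rewrite -ge0_mule_fsumr; last first.
  move=> r; apply: integral_ge0 => x _; rewrite lee_fin.
  exact: nnfun_muleindic_ge0.
congr (_ * _)%E; rewrite -ge0_integral_fsum//; last 2 first.
- by move=> r; apply/measurable_EFinP; apply: measurable_funM.
- by move=> r x _; rewrite lee_fin; exact: nnfun_muleindic_ge0.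
by apply: eq_integral => x _; rewrite fsumEFin// -fimfunE.
Qed.

End integral_prelim.

Section independence.
Context {d : measure_display} {T : measurableType d} {R : realType}.
Variable P : probability T R.
Context {I : choiceType} {D : set I}.
Variable Z : I -> {RV P >-> R}.
Hypothesis indepZ : mutually_independent P D Z.

Lemma integral_prod_indic (s : seq I) (B : I -> set R) :
  uniq s -> (forall i, i \in s -> D i) -> (forall i, measurable (B i)) ->
  (\int[P]_x (\prod_(i <- s) \1_(B i) (Z i x))%:E =
   \prod_(i <- s) P (Z i @^-1` B i))%E.
Proof.
move=> us sD mB.
have mZB i : measurable (Z i @^-1` B i).
  by rewrite -[X in measurable X]setTI; exact: measurable_funPT.
pose J := [fset i in s]%fset.
have JD : [set` J] `<=` D.
  by move=> i /=; rewrite !inE /=; exact: sD.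
have /= := indepZ JD mB.
have pJ : perm_eq J s.
  by apply: uniq_perm => // i; rewrite !inE.
rewrite (perm_big _ pJ)/= => <-.
rewrite -[X in P X]setIT -integral_indic//; last first.
  by apply: fin_bigcap_measurable => //; exact: finite_fset.
apply: eq_integral => x _; congr EFin.
rewrite [RHS]indicE; have [/set_mem xJ|/negP xJ] := boolP (x \in _).
  rewrite big1_seq// => i /andP[_ si]; rewrite indicE mem_set//.
  by apply: xJ; rewrite /= !inE.
have [i [si xi]] : exists i, i \in s /\ ~ B i (Z i x).
  apply: contrapT => /forallNP h; apply/xJ/mem_set => i /=; rewrite !inE/= => si.
  by apply: contrapT => nB; exact: (h i).
rewrite (big_rem i)//= indicE memNset//=; exact: mul0r.
Qed.

(** The induction that carries the product rule from events to functions: the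
    factors in [s1] are already arbitrary, those in [s2] are still indicators.
    Moving one index [a] from [s2] to [s1] is [ge0_integral_factor], with the
    product of all other factors as the weight [W]. *)
Lemma integral_prod_mixed (phi : I -> R -> R) (e : I -> R) :
  (forall i, measurable_fun setT (phi i)) -> (forall i z, 0 <= phi i z) ->
  (forall i, D i -> \int[P]_x (phi i (Z i x))%:E = (e i)%:E)%E ->
  forall (s1 s2 : seq I) (B : I -> set R),
  uniq (s1 ++ s2) -> (forall i, i \in s1 ++ s2 -> D i) ->
  (forall i, measurable (B i)) ->
  (\int[P]_x ((\prod_(i <- s1) phi i (Z i x)) *
              (\prod_(i <- s2) \1_(B i) (Z i x)))%:E =
   (\prod_(i <- s1) e i)%:E * \prod_(i <- s2) P (Z i @^-1` B i))%E.
Proof.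
move=> mphi phi0 phiE; elim=> [|a s1 IH] s2 B us sD mB.
  rewrite !big_nil mul1e -integral_prod_indic//.
  by apply: eq_integral => x _; rewrite big_nil mul1r.
move: (us); rewrite /= mem_cat negb_or => /andP[/andP[as1 as2] us12].
have e0 i : D i -> 0 <= e i.
  move=> Di; rewrite -lee_fin -phiE//; apply: integral_ge0 => x _.
  by rewrite lee_fin.
have Da : D a by apply: sD; rewrite mem_head.
have mZB i : measurable (Z i @^-1` B i).
  by rewrite -[X in measurable X]setTI; exact: measurable_funPT.
set p := (\prod_(i <- s2) P (Z i @^-1` B i))%E.
have pfin : p \is a fin_num.
  rewrite /p; elim: (s2) => [|i s IHs]; first by rewrite big_nil.
  by rewrite big_cons fin_numM// fin_num_measure.
have p0 : (0 <= p)%E.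
  rewrite /p; elim: (s2) => [|i s IHs]; first by rewrite big_nil.
  by rewrite big_cons mule_ge0.
(* [c] is real-valued, as [ge0_integral_factor] asks; [p] is a finite product
   of probabilities, so nothing is lost by [fine]. *)
pose W x := \prod_(i <- s1) phi i (Z i x) * \prod_(i <- s2) \1_(B i) (Z i x) : R.
pose c := \prod_(i <- s1) e i * fine p.
have c0 : 0 <= c.
  rewrite mulr_ge0 ?fine_ge0// big_seq prodr_ge0// => i is1; apply: e0.
  by apply: sD; rewrite inE mem_cat is1 orbT.
transitivity (\int[P]_x (W x * phi a (Z a x))%:E)%E.
  apply: eq_integral => x _; congr EFin.
  by rewrite big_cons -mulrA mulrC.
rewrite (@ge0_integral_factor _ _ _ _ W (Z a) c)//.
- rewrite phiE// -EFinM /c big_cons -[in RHS](fineK pfin) -EFinM.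
  by congr EFin; rewrite mulrC mulrA.
- by move=> x; rewrite mulr_ge0// prodr_ge0.
- apply: measurable_funM; apply: measurable_prod => i _.
    exact: measurableT_comp.
  have /(measurableT_comp (measurable_indic (mB i))) : measurable_fun setT (Z i) by [].
  exact.
- move=> C mC; pose B' i := if i == a then C else B i.
  have B'a : B' a = C by rewrite /B' eqxx.
  have B's i : i \in s2 -> B' i = B i.
    by rewrite /B' => is2; case: eqP is2 as2 => // -> ->.
  have mB' i : measurable (B' i) by rewrite /B'; case: ifP.
  have := IH (a :: s2) B'.
  rewrite -cat1s uniq_catCA/= => /(_ us) IHa.
  rewrite /c EFinM fineK//.
  transitivity (\int[P]_x (\prod_(i <- s1) phi i (Z i x) *
             \prod_(i <- a :: s2) \1_(B' i) (Z i x))%:E)%E.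
    apply: eq_integral => x _; congr EFin.
    rewrite /W big_cons B'a -!mulrA; congr (_ * _); rewrite mulrC.
    by congr (_ * _); apply: eq_big_seq => i /B's ->.
  rewrite IHa//.
    rewrite big_cons B'a -muleA; congr (_ * _)%E; rewrite muleC.
    by congr (_ * _)%E; apply: eq_big_seq => i /B's ->.
  move=> i; rewrite mem_cat inE => h; apply: sD; rewrite inE mem_cat.
  by rewrite orbCA.
Qed.

Lemma integral_prod_indep (phi : I -> R -> R) (e : I -> R) (s : seq I) :
  (forall i, measurable_fun setT (phi i)) -> (forall i z, 0 <= phi i z) ->
  (forall i, D i -> \int[P]_x (phi i (Z i x))%:E = (e i)%:E)%E ->
  uniq s -> (forall i, i \in s -> D i) ->
  (\int[P]_x (\prod_(i <- s) phi i (Z i x))%:E = (\prod_(i <- s) e i)%:E)%E.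
Proof.
move=> mphi phi0 phiE us sD.
have := @integral_prod_mixed phi e mphi phi0 phiE s [::] (fun=> setT).
rewrite cats0 big_nil mule1 => <-//.
by apply: eq_integral => x _; rewrite big_nil mulr1.
Qed.

End independence.

(** * Dominating functions and the empirical process *)

Section mean_bound.
Context {d : measure_display} {T : measurableType d} {R : realType}.
Variable P : probability T R.

(** The form in which suprema are controlled: [D] serves as a measurable
    majorant, and only its expectation matters afterwards. *)
Definition mean_bound (D : T -> R) (c : R) : Prop :=
  [/\ measurable_fun setT D, forall x, 0 <= D x
    & (\int[P]_x (D x)%:E <= c%:E)%E].

Lemma mean_boundD D1 D2 c1 c2 : mean_bound D1 c1 -> mean_bound D2 c2 ->
  mean_bound (fun x => D1 x + D2 x) (c1 + c2).
Proof.
move=> [m1 p1 i1] [m2 p2 i2]; split.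
- exact: measurable_funD.
- by move=> x; rewrite addr_ge0.
- under eq_integral do rewrite EFinD.
  rewrite ge0_integralD//; [|by move=> x _; rewrite lee_fin|exact/measurable_EFinP
    |by move=> x _; rewrite lee_fin|exact/measurable_EFinP].
  by rewrite EFinD leeD.
Qed.

Lemma mean_boundZ D c a : 0 <= a -> mean_bound D c ->
  mean_bound (fun x => a * D x) (a * c).
Proof.
move=> a0 [m p i]; split.
- exact: measurable_funM.
- by move=> x; rewrite mulr_ge0.
- under eq_integral do rewrite EFinM.
  rewrite ge0_integralZl_EFin//; [|by move=> x _; rewrite lee_fin|exact/measurable_EFinP].
  by rewrite EFinM lee_wpmul2l ?lee_fin.
Qed.

Lemma mean_bound_cst a : 0 <= a -> mean_bound (fun=> a) a.
Proof.
move=> a0; split => //.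
by rewrite integral_cst//= probability_setT mule1.
Qed.

Lemma mean_bound_le D c1 c2 : c1 <= c2 -> mean_bound D c1 -> mean_bound D c2.
Proof. by move=> c12 [? ? ?]; split => //; rewrite (le_trans _ (_ : c1%:E <= _)%E). Qed.

Lemma mean_bound_sum (I : eqType) (s : seq I) (D : I -> T -> R) (c : I -> R) :
  (forall i, i \in s -> mean_bound (D i) (c i)) ->
  mean_bound (fun x => \sum_(i <- s) D i x) (\sum_(i <- s) c i).
Proof.
elim: s => [_|a s IH h].
  rewrite big_nil (_ : (fun x => _) = fun=> 0); first exact: mean_bound_cst.
  by apply/funext => x; rewrite big_nil.
rewrite big_cons (_ : (fun x => _) = (fun x => D a x + \sum_(i <- s) D i x)).
  apply: mean_boundD; first by apply: h; rewrite mem_head.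
  by apply: IH => i is_; apply: h; rewrite inE is_ orbT.
by apply/funext => x; rewrite big_cons.
Qed.

End mean_bound.

(** From e^y <= 1 / (1 - y), where 1 <= (1 - y) (1 + y + 2 y^2) as long as
    y <= 1/2. *)
Lemma expR_le_quadratic (R : realType) (y : R) : y <= 2^-1 ->
  expR y <= 1 + y + 2 * y ^+ 2.
Proof.
move=> y2; have h := expR_ge1Dx (- y); rewrite expRN in h.
have e0 := expR_gt0 y.
have e1 : expR y * (1 - y) <= 1.
  by rewrite -[leRHS](mulfV (lt0r_neq0 e0)) ler_pM2l.
have p : 0 < 1 - y by lra.
rewrite -(ler_pM2r p); apply: (le_trans e1).
rewrite [leRHS](_ : _ = 1 + y ^+ 2 * (1 - 2 * y)); last by ring.
by rewrite lerDl mulr_ge0 ?sqr_ge0//; lra.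
Qed.

Section empirical.
Context {d : measure_display} {T : measurableType d} {R : realType}.
Variable P : probability T R.
Variable Z : nat -> {RV P >-> R}.

(** The common mean is computed at [Z 1], the reference variable of the i.i.d.
    sequence. *)
Definition mean (g : R -> R) : R := (\int[P]_x g (Z 1%N x))%R.

(** The empirical process at [g], normalized as in [char_process]. *)
Definition emp (n : nat) (g : R -> R) (x : T) : R :=
  n%:R `^ (- 2^-1) * \sum_(1 <= t < n.+1) (g (Z t x) - mean g).

Hypothesis Z_iid : iid P Z.

Lemma iid_integral (g : R -> R) (t : nat) : (1 <= t)%N ->
  measurable_fun setT g -> (forall z, 0 <= g z) ->
  (\int[P]_x (g (Z t x))%:E = \int[P]_x (g (Z 1%N x))%:E)%E.
Proof.
move=> t1 /measurable_EFinP mg g0.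
have h t' : (\int[P]_x (g (Z t' x))%:E =
             \int[distribution P (Z t')]_y (g y)%:E)%E.
  by rewrite ge0_integral_distribution// => y; rewrite lee_fin.
rewrite !h; apply: eq_measure_integral => A mA _.
exact: (Z_iid.2 t 1%N).
Qed.

Lemma dom_integrable (g K : R -> R) (k : R) :
  measurable_fun setT g -> measurable_fun setT K -> (forall z, `|g z| <= K z) ->
  (\int[P]_x (K (Z 1%N x))%:E <= k%:E)%E ->
  P.-integrable setT (fun x => (g (Z 1%N x))%:E).
Proof.
move=> mg mK gK Kk.
have mgZ : measurable_fun setT (fun x => g (Z 1%N x)) by exact: measurableT_comp.
apply/integrableP; split; first exact/measurable_EFinP.
apply: le_lt_trans (ltry k); apply: le_trans Kk.
apply: ge0_le_integral_nomeas => x //=.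
by rewrite lee_fin.
Qed.

Lemma mean_le (g K : R -> R) (k : R) :
  measurable_fun setT g -> measurable_fun setT K -> (forall z, `|g z| <= K z) ->
  (\int[P]_x (K (Z 1%N x))%:E <= k%:E)%E -> `|mean g| <= k.
Proof.
move=> mg mK gK Kk.
have ig := dom_integrable mg mK gK Kk.
rewrite /mean; apply: le_trans (le_normr_Rintegral measurableT ig) _.
rewrite -lee_fin /Rintegral fineK; last first.
  apply: integrable_fin_num => //; exact: (integrable_norm ig).
apply: le_trans Kk; apply: ge0_le_integral_nomeas => x //=.
  by rewrite lee_fin.
Qed.

Lemma empB n (g h : R -> R) x :
  P.-integrable setT (fun x => (g (Z 1%N x))%:E) ->
  P.-integrable setT (fun x => (h (Z 1%N x))%:E) ->
  emp n (fun z => g z - h z) x = emp n g x - emp n h x.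
Proof.
move=> ig ih; rewrite /emp -mulrBr -sumrB; congr (_ * _).
by apply: eq_bigr => t _; rewrite /mean RintegralB//; lra.
Qed.

Lemma empZ n (a : R) (g : R -> R) x :
  P.-integrable setT (fun x => (g (Z 1%N x))%:E) ->
  emp n (fun z => a * g z) x = a * emp n g x.
Proof.
move=> ig; rewrite /emp [RHS]mulrCA; congr (_ * _); rewrite mulr_sumr.
by apply: eq_bigr => t _; rewrite /mean RintegralZl//; lra.
Qed.

(** The triangle inequality, without any cancellation between the summands.
    One majorant serves all [g] with envelope [K], even uncountably many; the
    price is the factor sqrt n. *)
Lemma crude_bound (n : nat) (K : R -> R) (k : R) : (1 <= n)%N ->
  measurable_fun setT K -> (forall z, 0 <= K z) ->
  (\int[P]_x (K (Z 1%N x))%:E <= k%:E)%E ->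
  exists2 D : T -> R, mean_bound P D (2 * Num.sqrt n%:R * k)
    & forall g : R -> R, measurable_fun setT g -> (forall z, `|g z| <= K z) ->
      forall x, `|emp n g x| <= D x.
Proof.
move=> n1 mK K0 Kk.
have k0 : 0 <= k.
  rewrite -lee_fin; apply: le_trans Kk; apply: integral_ge0 => x _.
  by rewrite lee_fin.
have n0 : (0 : R) < n%:R by rewrite ltr0n.
have rE : n%:R `^ (- 2^-1) * n%:R = Num.sqrt n%:R :> R.
  rewrite -{2}(sqr_sqrtr (ltW n0)) powRN powR12_sqrt ?ltW// expr2 mulKf//.
  by rewrite sqrtr_eq0 -ltNge.
exists (fun x => n%:R `^ (- 2^-1) * \sum_(1 <= t < n.+1) (K (Z t x) + k)).
  apply: (@mean_bound_le _ _ _ _ _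
     (n%:R `^ (- 2^-1) * \sum_(1 <= t < n.+1) (k + k))).
    rewrite sumr_const_nat subn1 /= -[(k + k) *+ n]mulr_natr mulrCA rE.
    lra.
  apply: mean_boundZ; first exact: powR_ge0.
  apply: mean_bound_sum => t; rewrite mem_index_iota => /andP[t1 _].
  apply: mean_boundD; last exact: mean_bound_cst.
  by split => //; [exact: measurableT_comp|rewrite iid_integral].
move=> g mg gK x; rewrite /emp normrM ger0_norm ?powR_ge0//.
apply: ler_wpM2l; first exact: powR_ge0.
apply: le_trans (ler_norm_sum _ _ _) _; apply: ler_sum => t _.
apply: le_trans (ler_normB _ _) _; rewrite lerD//.
exact: mean_le Kk.
Qed.

(** By independence the left-hand side is the n-th power of
    E exp(s (g - E g)).  The smallness condition on [s] makes the quadratic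
    bound on the exponential available, so that
    E e^(s g) <= 1 + s E g + 2 s^2 V <= e^(s E g + 2 s^2 V). *)
Lemma emp_mgf (n : nat) (g : R -> R) (tau s V : R) :
  measurable_fun setT g -> (forall z, `|g z| <= tau) -> `|s| * tau <= 2^-1 ->
  (\int[P]_x (g (Z 1%N x) ^+ 2)%:E <= V%:E)%E ->
  (\int[P]_x (expR (s * \sum_(1 <= t < n.+1) (g (Z t x) - mean g)))%:E
    <= (expR (2 * n%:R * s ^+ 2 * V))%:E)%E.
Proof.
move=> mg gtau stau gV.
set m := mean g.
have mgZ : measurable_fun setT (fun x => g (Z 1%N x)) by exact: measurableT_comp.
have mg2 : measurable_fun setT (fun z => g z ^+ 2) by exact: measurable_funX.
have ig : P.-integrable setT (fun x => (g (Z 1%N x))%:E).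
  apply: (@dom_integrable g (fun=> tau) tau) => //.
  by rewrite integral_cst//= probability_setT mule1.
have ig2 : P.-integrable setT (fun x => (g (Z 1%N x) ^+ 2)%:E).
  apply: (@dom_integrable (fun z => g z ^+ 2) (fun z => g z ^+ 2) V) => //.
  by move=> z; rewrite ger0_norm// sqr_ge0.
pose phi (z : R) := expR (s * (g z - m)).
have mphi : measurable_fun setT phi.
  apply: measurableT_comp => //; apply: measurable_funM => //.
  exact: measurable_funB.
have phi1 : (\int[P]_x (phi (Z 1%N x))%:E <= (expR (2 * s ^+ 2 * V))%:E)%E.
  apply: (@le_trans _ _ (\int[P]_x (expR (- (s * m)) *
     (1 + s * g (Z 1%N x) + (2 * s ^+ 2) * g (Z 1%N x) ^+ 2))%:E)%E).
    apply: ge0_le_integral_nomeas => x; rewrite lee_fin ?expR_ge0//.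
    rewrite /phi mulrBr expRD mulrC ler_wpM2l ?expR_ge0//.
    rewrite -mulrA -exprMn; apply: expR_le_quadratic.
    apply: le_trans (ler_norm _) _; rewrite normrM.
    by apply: le_trans _ stau; rewrite ler_wpM2l.
  have i1 : P.-integrable setT (fun x => (1 : R)%:E).
    exact: finite_measure_integrable_cst.
  have i2 : P.-integrable setT (fun x => (s * g (Z 1%N x))%:E).
    by under eq_fun do rewrite EFinM; exact: integrableZl.
  have i3 : P.-integrable setT (fun x => ((2 * s ^+ 2) * g (Z 1%N x) ^+ 2)%:E).
    by under eq_fun do rewrite EFinM; exact: integrableZl.
  have i12 : P.-integrable setT (fun x => (1 + s * g (Z 1%N x))%:E).
    by under eq_fun do rewrite EFinD; exact: integrableD.
  have i123 : P.-integrable setT (fun x =>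
      (1 + s * g (Z 1%N x) + (2 * s ^+ 2) * g (Z 1%N x) ^+ 2)%:E).
    by under eq_fun do rewrite EFinD; exact: integrableD.
  under eq_integral do rewrite EFinM.
  rewrite integralZl//.
  rewrite -[X in (_ * X)%E]fineK ?integrable_fin_num//.
  rewrite -[fine _]/(\int[P]_x _)%R.
  rewrite RintegralD// RintegralD// !RintegralZl// Rintegral_cst//.
  rewrite [fine _](_ : _ = 1); last exact: (congr1 fine (probability_setT P)).
  rewrite -EFinM lee_fin.
  have v : \int[P]_x (g (Z 1%N x) ^+ 2) <= V.
    by rewrite -lee_fin /Rintegral fineK// integrable_fin_num.
  rewrite -[(\int[P]_x g (Z 1%N x))%R]/m.
  rewrite [leRHS](_ : _ = expR (- (s * m)) * expR (s * m + 2 * s ^+ 2 * V)); last first.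
    by rewrite -expRD; congr expR; lra.
  rewrite ler_wpM2l ?expR_ge0//.
  apply: le_trans (expR_ge1Dx _); rewrite mul1r addrA lerD2l ler_wpM2l//.
  by rewrite mulr_ge0// sqr_ge0.
have phi0 z : 0 <= phi z by exact: expR_ge0.
have efin : (\int[P]_x (phi (Z 1%N x))%:E)%E \is a fin_num.
  rewrite ge0_fin_numE; last by apply: integral_ge0 => x _; rewrite lee_fin.
  by apply: le_lt_trans phi1 _; exact: ltry.
pose e := fine (\int[P]_x (phi (Z 1%N x))%:E)%E.
have e0 : 0 <= e by apply: fine_ge0; apply: integral_ge0 => x _; rewrite lee_fin.
have eV : e <= expR (2 * s ^+ 2 * V) by rewrite -lee_fin /e fineK.
under eq_integral => x _.
  rewrite mulr_sumr expR_sum.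
  rewrite -[X in X%:E]/(\prod_(1 <= t < n.+1) phi (Z t x)).
  over.
rewrite (@integral_prod_indep _ _ _ P _ _ Z Z_iid.1 (fun=> phi) (fun=> e))//.
- rewrite lee_fin prodr_const_nat subn1 /=.
  apply: le_trans (_ : expR (2 * s ^+ 2 * V) ^+ n <= _).
    by rewrite lerXn2r// ?nnegrE ?expR_ge0.
  by rewrite -expRM_natl ler_expR; lra.
- by move=> t t1; rewrite iid_integral// /e fineK.
- exact: iota_uniq.
- by move=> t; rewrite mem_index_iota => /andP[].
Qed.

End empirical.

(** * The maximal inequality for finite families *)

Section maximal.
Context {d : measure_display} {T : measurableType d} {R : realType}.
Variable P : probability T R.
Variable Z : nat -> {RV P >-> R}.
Hypothesis Z_iid : iid P Z.

(** F <= 1 + F^2 pointwise; avoids Cauchy-Schwarz at the price of a worse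
    constant. *)
Lemma integral_le_square (F : R -> R) (V : R) :
  measurable_fun setT F -> (forall z, 0 <= F z) ->
  (\int[P]_x (F (Z 1%N x) ^+ 2)%:E <= V%:E)%E ->
  (\int[P]_x (F (Z 1%N x))%:E <= (1 + V)%:E)%E.
Proof.
move=> mF F0 FV.
have mF2 : measurable_fun setT (fun x => F (Z 1%N x) ^+ 2).
  by apply: measurable_funX; exact: measurableT_comp.
apply: (@le_trans _ _ (\int[P]_x (1 + F (Z 1%N x) ^+ 2)%:E)%E).
  apply: ge0_le_integral_nomeas => x; rewrite lee_fin//.
  by have := sqr_ge0 (F (Z 1%N x) - 2^-1); nra.
under eq_integral do rewrite EFinD.
rewrite ge0_integralD//; [|by move=> y _; rewrite lee_fin sqr_ge0|exact/measurable_EFinP].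
by rewrite integral_cst//= probability_setT mule1 EFinD leeD2l.
Qed.

Lemma dom_integrable2 (h F : R -> R) (V : R) :
  measurable_fun setT h -> measurable_fun setT F -> (forall z, `|h z| <= F z) ->
  (\int[P]_x (F (Z 1%N x) ^+ 2)%:E <= V%:E)%E ->
  P.-integrable setT (fun x => (h (Z 1%N x))%:E).
Proof.
move=> mh mF hF FV; apply: (dom_integrable mh mF hF).
apply: integral_le_square FV => // z; exact: le_trans (hF z).
Qed.

(** At s = +- sqrt L the argument of the exponential is (s n^(-1/2)) times the
    sum, and s n^(-1/2) = sqrt (L/n) is exactly what the truncation level
    sqrt (n/L) / 2 allows in [emp_mgf]. *)
Lemma mean_bound_expR_emp (n : nat) (g : R -> R) (L V s : R) :
  (1 <= n)%N -> 0 < L -> measurable_fun setT g ->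
  (forall z, `|g z| <= Num.sqrt (n%:R / L) / 2) ->
  (\int[P]_x (g (Z 1%N x) ^+ 2)%:E <= V%:E)%E -> `|s| = Num.sqrt L ->
  mean_bound P (fun x => expR (s * emp Z n g x)) (expR (2 * L * V)).
Proof.
move=> n1 L0 mg gt gV sL.
have n0 : (0 : R) < n%:R by rewrite ltr0n.
have memp : measurable_fun setT (emp Z n g).
  apply: measurable_funM => //; apply: measurable_sum => t.
  by apply: measurable_funB => //; exact: measurableT_comp.
split; last 1 first.
- have := @emp_mgf _ _ _ P Z Z_iid n g _ (s * n%:R `^ (- 2^-1)) V mg gt.
  rewrite /emp; under [in X in _ -> X]eq_integral do rewrite mulrA.
  have rE : `|s * n%:R `^ (- 2^-1)| = Num.sqrt (L / n%:R).
    rewrite normrM sL ger0_norm ?powR_ge0// powRN powR12_sqrt 1?ltW//.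
    by rewrite sqrtrM ?ltW// sqrtrV// ltW.
  have -> : 2 * n%:R * (s * n%:R `^ (- 2^-1)) ^+ 2 * V = 2 * L * V.
    rewrite -(real_normK (num_real (s * _))) rE sqr_sqrtr ?divr_ge0 ?ltW//.
    by field; rewrite gt_eqF.
  apply => //; rewrite rE mulrA -sqrtrM; last by rewrite divr_ge0 ?ltW.
  rewrite [X in Num.sqrt X](_ : _ = 1) ?sqrtr1 ?mul1r ?lexx//.
  by rewrite mulrA mulfVK ?gt_eqF// mulfV ?gt_eqF.
- by apply: measurableT_comp => //; exact: measurable_funM.
- by move=> x; exact: expR_ge0.
Qed.


(** Split f_i = g_i + r_i by truncating where the envelope exceeds tau.  The
    rests r_i are dominated by F^2 / tau and go to [crude_bound].  For the
    bounded parts, y <= a + e^(y - a) with y = sqrt L |G_n(g_i)| replaces the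
    maximum by a sum of exponentials, and a = L (1 + 2V) is chosen so that
    e^(-a) cancels both the cardinality e^L and the moment generating
    function e^(2LV). *)
Lemma expectation_max_emp (I : eqType) (s : seq I) (f : I -> R -> R)
    (F : R -> R) (V L : R) (n : nat) :
  (1 <= n)%N -> 1 <= L -> (size s)%:R <= expR L ->
  measurable_fun setT F -> (forall i, measurable_fun setT (f i)) ->
  (forall i z, i \in s -> `|f i z| <= F z) ->
  (\int[P]_x (F (Z 1%N x) ^+ 2)%:E <= V%:E)%E ->
  exists2 D : T -> R, mean_bound P D ((3 + 6 * V) * Num.sqrt L)
    & forall i x, i \in s -> `|emp Z n (f i) x| <= D x.
Proof.
move=> n1 L1 sL mF mf fF FV.
have L0 : 0 < L by lra.
have n0 : (0 : R) < n%:R by rewrite ltr0n.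
have V0 : 0 <= V.
  rewrite -lee_fin; apply: le_trans FV; apply: integral_ge0 => x _.
  by rewrite lee_fin sqr_ge0.
pose rL := Num.sqrt L.
have rL0 : 0 < rL by rewrite sqrtr_gt0.
have rLL : rL * rL = L by rewrite -expr2 sqr_sqrtr// ltW.
pose tau := Num.sqrt (n%:R / L) / 2.
have tau0 : 0 < tau by rewrite divr_gt0// sqrtr_gt0 divr_gt0.
pose A := F @^-1` `]-oo, tau]%classic.
have mA : measurable A by rewrite -[X in measurable X]setTI; exact: mF.
pose g i z := f i z * \1_A z.
pose r i z := f i z - g i z.
have mg i : measurable_fun setT (g i) by apply: measurable_funM.
have mr i : measurable_fun setT (r i) by apply: measurable_funB.
have AP z : (z \in A) = (F z <= tau).
  by apply/idP/idP; rewrite inE /A /= in_itv.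
have gtau i z : i \in s -> `|g i z| <= tau.
  move=> si; rewrite /g indicE AP; case: (leP (F z) tau) => [h|_].
    by rewrite mulr1; exact: le_trans (fF i z si) h.
  by rewrite mulr0 normr0 ltW.
have gF i z : i \in s -> `|g i z| <= F z.
  move=> si; rewrite /g indicE AP; case: (leP (F z) tau) => [h|_].
    by rewrite mulr1 fF.
  by rewrite mulr0 normr0; apply: le_trans (fF i z si).
pose K z := tau^-1 * F z ^+ 2.
have mK : measurable_fun setT K.
  by apply: measurable_funM => //; exact: measurable_funX.
have K0 z : 0 <= K z by rewrite mulr_ge0 ?sqr_ge0// invr_ge0 ltW.
have rK i z : i \in s -> `|r i z| <= K z.
  move=> si; rewrite /r /g indicE AP; case: (leP (F z) tau) => [h|h].
    by rewrite mulr1 subrr normr0.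
  rewrite mulr0 subr0; apply: le_trans (fF i z si) _; rewrite /K expr2 mulrA ler_peMl//.
    by rewrite ltW// (lt_trans tau0).
  by rewrite mulrC ler_pdivlMr// mul1r ltW.
have mF2 : measurable_fun setT (fun x => F (Z 1%N x) ^+ 2).
  by apply: measurable_funX; exact: measurableT_comp.
have KV : (\int[P]_x (K (Z 1%N x))%:E <= (tau^-1 * V)%:E)%E.
  rewrite /K; under eq_integral do rewrite EFinM.
  rewrite ge0_integralZl_EFin//.
  - by rewrite EFinM lee_wpmul2l// lee_fin invr_ge0 ltW.
  - by move=> x _; rewrite lee_fin sqr_ge0.
  - exact/measurable_EFinP.
  - by rewrite invr_ge0 ltW.
have [D2 D2b D2P] := crude_bound Z_iid n1 mK K0 KV.
pose a := L * (1 + 2 * V).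
pose D1 x := rL^-1 * (a + \sum_(i <- s) expR (- a) *
  (expR (rL * emp Z n (g i) x) + expR (- rL * emp Z n (g i) x))).
have g2V i : i \in s -> (\int[P]_x (g i (Z 1%N x) ^+ 2)%:E <= V%:E)%E.
  move=> si; apply: le_trans FV; apply: ge0_le_integral_nomeas => x.
    by rewrite lee_fin sqr_ge0.
  rewrite lee_fin -real_normK ?num_real// lerXn2r// ?nnegrE//.
    exact: le_trans (gF _ _ si).
  exact: gF.
have a0 : 0 <= a by rewrite mulr_ge0// ?ltW//; lra.
have D1b : mean_bound P D1 (rL^-1 * (a + \sum_(i <- s) expR (- a) *
    (expR (2 * L * V) + expR (2 * L * V)))).
  apply: mean_boundZ; first by rewrite invr_ge0 ltW.
  apply: mean_boundD; first exact: mean_bound_cst.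
  apply: mean_bound_sum => i si; apply: mean_boundZ; first exact: expR_ge0.
  apply: mean_boundD; apply: mean_bound_expR_emp => //.
  - by move=> z; exact: gtau.
  - exact: g2V.
  - by rewrite ger0_norm// ltW.
  - by move=> z; exact: gtau.
  - exact: g2V.
  - by rewrite normrN ger0_norm// ltW.
exists (fun x => D1 x + D2 x).
  have -> : (3 + 6 * V) * Num.sqrt L =
      (3 + 2 * V) * rL + 2 * Num.sqrt n%:R * (tau^-1 * V).
    have -> : Num.sqrt n%:R = 2 * tau * rL.
      rewrite /tau mulrCA mulfV// mulr1 -sqrtrM ?divr_ge0 ?ltW//.
      by rewrite mulfVK// gt_eqF.
    by rewrite -/rL; field; rewrite gt_eqF.
  apply: mean_boundD => //; apply: mean_bound_le D1b.
  rewrite big_const_seq count_predT iter_addr_0 -[_ *+ size s]mulr_natr.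
  rewrite [leLHS]mulrC ler_pdivrMr// -[leRHS]mulrA rLL.
  have -> : expR (- a) * (expR (2 * L * V) + expR (2 * L * V)) = 2 * expR (- L).
    rewrite mulrDr -expRD [X in expR X](_ : _ = - L); last by rewrite /a; ring.
    by ring.
  have : expR (- L) * (size s)%:R <= 1.
    by rewrite expRN mulrC ler_pdivrMr ?expR_gt0// mul1r.
  rewrite /a => h.
  lra.
move=> i x si.
have := D2P (r i) (mr i) (fun z => rK i z si) x.
rewrite /r empB; last 2 first.
- by apply: (dom_integrable2 (mf i) mF _ FV) => z; exact: fF.
- by apply: (dom_integrable2 (mg i) mF _ FV) => z; exact: gF.
move=> h2.
have h1 : `|emp Z n (g i) x| <= D1 x.
  set y := emp Z n (g i) x.
  rewrite /D1 mulrC ler_pdivlMr// (big_rem i)//= -/y.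
  apply: (@le_trans _ _ (a + expR (rL * `|y| - a))).
    by have := expR_ge1Dx (rL * `|y| - a); rewrite mulrC; lra.
  rewrite lerD2l -[leLHS]addr0 lerD//; last first.
    by apply: sumr_ge0 => j _; rewrite mulr_ge0 ?addr_ge0 ?expR_ge0.
  rewrite addrC expRD ler_wpM2l ?expR_ge0//.
  have [y0|y0] := leP 0 y.
    by rewrite ger0_norm// lerDl expR_ge0.
  by rewrite ltr0_norm// mulrN -mulNr lerDr expR_ge0.
rewrite -[emp Z n (f i) x](subrK (emp Z n (g i) x)).
by rewrite (le_trans (ler_normD _ _))// addrC lerD.
Qed.

End maximal.

(** * Grids, scales and weights *)

Section grids.
Context {R : realType}.
Implicit Types (u v : R) (l M : nat).

(** The multiples of 1/M in [-M, M]. *)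
Definition grid M : seq R :=
  [seq j%:R / M%:R - M%:R | j <- iota 0 (2 * M ^ 2).+1].

Lemma grid_approx M u : (0 < M)%N -> `|u| <= M%:R ->
  exists2 v, v \in grid M & `|u - v| <= M%:R^-1.
Proof.
move=> M0 uM; have M0R : (0 : R) < M%:R by rewrite ltr0n.
move: uM; rewrite ler_norml => /andP[u1 u2].
pose y := (u + M%:R) * M%:R.
have y0 : 0 <= y by rewrite mulr_ge0//; lra.
have /andP[ty yt] := truncn_itv y0.
exists ((Num.truncn y)%:R / M%:R - M%:R).
  apply/mapP; exists (Num.truncn y) => //; rewrite mem_iota /= add0n ltnS.
  rewrite -(ler_nat R); apply: le_trans ty _.
  rewrite natrM natrX expr2 /y.
  nra.
rewrite [X in `|X|](_ : _ = (y - (Num.truncn y)%:R) / M%:R); last first.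
  by rewrite /y; field; rewrite gt_eqF.
rewrite normrM (@ger0_norm _ M%:R^-1) ?invr_ge0 ?ler0n//.
rewrite ler_piMl ?invr_ge0 ?ler0n//.
rewrite ger0_norm ?subr_ge0//.
by move: yt; rewrite -natr1; lra.
Qed.

(** Doubly exponential, so that the logarithms of the range, of the mesh and of
    the cardinality of the l-th grid are all of order 2^l. *)
Definition scale l : nat := (2 ^ (2 ^ l))%N.

Lemma scale_gt0 l : (0 < scale l)%N. Proof. by rewrite expn_gt0. Qed.

Lemma scaleE l : (scale l)%:R = 2 ^+ (2 ^ l) :> R.
Proof. by rewrite natrX. Qed.

Lemma ler_scale l m : (l <= m)%N -> (scale l)%:R <= (scale m)%:R :> R.
Proof. by move=> lm; rewrite ler_nat !leq_pexp2l. Qed.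

Lemma exp2_le_expR m : 2 ^+ m <= expR m%:R :> R.
Proof.
rewrite -[m%:R]mulr1 expRM_natl lerXn2r ?nnegrE ?expR_ge0//.
by have := expR_ge1Dx (1 : R); lra.
Qed.

Lemma size_grid_scale l : (size (grid (scale l)))%:R <= expR (4 * 2 ^+ l) :> R.
Proof.
rewrite size_map size_iota.
apply: (@le_trans _ _ ((scale l) ^ 4)%:R).
  rewrite ler_nat.
  have : (2 <= scale l)%N by rewrite /scale -[X in (X <= _)%N](expn1 2) leq_pexp2l// expn_gt0.
  move: (scale l) => M M2.
  have N4 : (4 <= M ^ 2)%N by rewrite -[4%N]/(2 ^ 2)%N leq_sqr.
  rewrite (_ : M ^ 4 = M ^ 2 * M ^ 2)%N; last by rewrite -expnD.
  apply: (@leq_trans (M ^ 2 * 4)%N); last by rewrite leq_mul2l N4 orbT.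
  rewrite mulnC -addn1 (_ : M ^ 2 * 4 = M ^ 2 * 2 + M ^ 2 * 2)%N; last first.
    by rewrite -mulnDr.
  by rewrite leq_add2l muln_gt0 (leq_trans _ N4).
rewrite natrX scaleE -exprM.
by apply: le_trans (exp2_le_expR _) _; rewrite ler_expR natrM natrX mulrC.
Qed.

(** The increments of the chain: pairs of points of two successive grids that
    can both approximate the same real number. *)
Definition links l : seq (R * R) :=
  [seq p <- [seq (a, b) | a <- grid (scale l.+1), b <- grid (scale l)]
  | `|p.1 - p.2| <= 2 / (scale l)%:R].

Lemma size_links l : (size (links l))%:R <= expR (12 * 2 ^+ l) :> R.
Proof.
apply: (@le_trans _ _ (size [seq (a, b) | a <- grid (scale l.+1), b <- grid (scale l)])%:R).
  by rewrite ler_nat size_filter count_size.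
rewrite size_allpairs natrM.
apply: (@le_trans _ _ (expR (4 * 2 ^+ l.+1) * expR (4 * 2 ^+ l))).
  by rewrite ler_pM// size_grid_scale.
by rewrite -expRD exprS ler_expR; lra.
Qed.

Lemma ln2_ge : 2^-1 <= ln 2 :> R.
Proof.
rewrite -ler_expR lnK ?posrE//.
by apply: le_trans (expR_le_quadratic (lexx _)) _; lra.
Qed.

Lemma powRN_le (x y a : R) : 0 < x -> x <= y -> 0 <= a ->
  y `^ (- a) <= x `^ (- a).
Proof.
move=> x0 xy a0; have y0 : 0 < y by exact: lt_le_trans xy.
rewrite !powRN lef_pV2 ?posrE ?powR_gt0//.
by rewrite ge0_ler_powR// nnegrE ltW.
Qed.

Lemma ln_weight_ge1 u : 1 <= ln (expR 1 + `|u|).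
Proof.
rewrite -ler_expR lnK ?lerDl// posrE.
by rewrite ltr_wpDr// expR_gt0.
Qed.

Lemma weight_ge0 (delta : R) u : 0 <= weight delta u.
Proof. exact: powR_ge0. Qed.

Lemma weight_le1 (delta : R) u : 0 < delta -> weight delta u <= 1.
Proof.
move=> d0; rewrite /weight -opprD.
apply: le_trans (powRN_le _ (ln_weight_ge1 u) _) _ => //; first by lra.
by rewrite powR1.
Qed.

(** What [weight] amounts to at the first scale that reaches |u|: there
    log(e + |u|) is at least 2^l / 4. *)
Definition scale_weight (delta : R) l : R := (2 ^+ l / 4) `^ (- (2^-1 + delta)).

(** The hypothesis says that no scale before the l-th one exceeds |u|; for
    l = 0 it is void. *)
Lemma weight_le_scale (delta : R) l u : 0 < delta ->
  (forall m, l = m.+1 -> (scale m)%:R <= `|u|) ->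
  weight delta u <= scale_weight delta l.
Proof.
move=> d0 h; rewrite /weight /scale_weight -opprD; apply: powRN_le.
- by rewrite divr_gt0// exprn_gt0.
- case: l h => [_|m /(_ m erefl) h].
    by apply: le_trans (ln_weight_ge1 u); rewrite expr0; lra.
  have s0 : 0 < 2 ^+ (2 ^ m) :> R by exact: exprn_gt0.
  apply: (@le_trans _ _ (ln (2 ^+ (2 ^ m)))).
    rewrite lnXn// exprS -[ln 2 *+ _]mulr_natr natrX.
    have := ln2_ge; have : 0 <= 2 ^+ m :> R by exact: exprn_ge0.
    nra.
  rewrite ler_ln ?posrE//.
  rewrite -scaleE; apply: (le_trans h); rewrite lerDr; exact: expR_ge0.
- lra.
Qed.

(** The exponent -1/2 of the weight cancels the entropy factor of the l-th grid;
    the exponent -delta is left as the ratio of a geometric series. *)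
Lemma scale_weight_sqrt (delta : R) l :
  scale_weight delta l * Num.sqrt (4 * 2 ^+ l) =
  4 * 4 `^ delta * (2 `^ (- delta)) ^+ l.
Proof.
have p0 : 0 < 2 ^+ l / 4 :> R by rewrite divr_gt0// exprn_gt0.
rewrite /scale_weight opprD powRD; last by rewrite (gt_eqF p0) implybT.
rewrite [X in _ * Num.sqrt X](_ : _ = 4 ^+ 2 * (2 ^+ l / 4)); last by field.
rewrite sqrtrM// sqrtr_sqr ger0_norm// -powR12_sqrt ?(ltW p0)//.
set y := 2 ^+ l / 4 in p0 *.
rewrite (_ : y `^ (- 2^-1) * y `^ (- delta) * (4 * y `^ 2^-1) =
    4 * (y `^ 2^-1 * y `^ (- 2^-1)) * y `^ (- delta)); last by ring.
rewrite -powRD; last by rewrite (gt_eqF p0) implybT.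
rewrite addrN powRr0 mulr1 -mulrA; congr (_ * _).
rewrite /y powRM ?invr_ge0 ?exprn_ge0// mulrC; congr (_ * _).
  by rewrite -powR_inv1// -powRrM mulN1r opprK.
rewrite -(powR_mulrn l (ler0n R 2)) -(powR_mulrn l (powR_ge0 2 (- delta))).
by rewrite -!powRrM mulrC.
Qed.

(** Because the scale is e^(2^l log 2), one application of y <= e^y turns a
    power of the mesh into 2^(-l); that is already enough against the entropy
    factor, which is of order 2^(l/2). *)
Lemma scale_powR (a : R) l : 0 < a -> a <= 1 ->
  (2 / (scale l)%:R) `^ a <= 4 / a / 2 ^+ l.
Proof.
move=> a0 a1.
have e0 : 0 < 2 ^+ l :> R by exact: exprn_gt0.
rewrite powRM ?invr_ge0//.
apply: (@le_trans _ _ (2 * (2 / a / 2 ^+ l))); last by rewrite !mulrA -natrM.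
apply: ler_pM; rewrite ?powR_ge0//.
  by rewrite -[leRHS]powRr1// ler_powR// ler1n.
rewrite -powR_inv1 ?ler0n// -powRrM mulN1r powRN scaleE -powR_mulrn// -powRrM.
rewrite -invf_div lef_pV2 ?posrE ?powR_gt0//; last by rewrite !(mulr_gt0, divr_gt0)// invr_gt0 divr_gt0.
rewrite invf_div natrX.
rewrite /powR gt_eqF//.
apply: le_trans (_ : 2 ^+ l * a * ln 2 <= _).
  have := ln2_ge; have : 0 < 2 ^+ l * a by exact: mulr_gt0.
  nra.
by have := expR_ge1Dx (2 ^+ l * a * ln 2); lra.
Qed.

Lemma geometric_sum_le (q : R) m : 0 <= q -> q < 1 ->
  \sum_(0 <= i < m) q ^+ i <= (1 - q)^-1.
Proof.
move=> q0 q1; have p : 0 < 1 - q by lra.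
rewrite -[leRHS]mul1r ler_pdivlMr// big_mkord mulrC.
have := subrX1 q m; have := exprn_ge0 m q0; lra.
Qed.

End grids.

(** * Chaining *)

Section chaining.
Context {d : measure_display} {T : measurableType d} {R : realType}.
Variable P : probability T R.
Variable Z : nat -> {RV P >-> R}.
Hypothesis Z_iid : iid P Z.
Variables (f : R -> R -> R) (F H : R -> R) (V alpha delta : R).
Hypotheses (alpha_gt0 : 0 < alpha) (alpha_le1 : alpha <= 1).
Hypothesis delta_gt0 : 0 < delta.
Hypotheses (mf : forall u, measurable_fun setT (f u))
  (mF : measurable_fun setT F) (mH : measurable_fun setT H).
Hypotheses (fF : forall u z, `|f u z| <= F z) (H0 : forall z, 0 <= H z)
  (fH : forall u v z, `|f u z - f v z| <= `|u - v| `^ alpha * H z).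
Hypotheses (FV : (\int[P]_x (F (Z 1%N x) ^+ 2)%:E <= V%:E)%E)
  (HV : (\int[P]_x (H (Z 1%N x) ^+ 2)%:E <= V%:E)%E).

Let C := 3 + 6 * V.
(* The Hoelder factor of an increment along a link of level [l]. *)
Let step l : R := (2 / (scale l)%:R) `^ alpha.

Let V0 : 0 <= V.
Proof.
rewrite -lee_fin; apply: le_trans FV; apply: integral_ge0 => x _.
by rewrite lee_fin sqr_ge0.
Qed.

Let step_gt0 l : 0 < step l.
Proof. by rewrite powR_gt0// divr_gt0// ltr0n scale_gt0. Qed.

Let int_f u : P.-integrable setT (fun x => (f u (Z 1%N x))%:E).
Proof. exact: (dom_integrable2 (mf u) mF (fF u) FV). Qed.

Lemma bound_on_grid n l : (1 <= n)%N ->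
  exists2 D : T -> R, mean_bound P D (C * Num.sqrt (4 * 2 ^+ l))
    & forall u x, u \in grid (scale l) -> `|emp Z n (f u) x| <= D x.
Proof.
move=> n1; have L1 : 1 <= 4 * 2 ^+ l :> R.
  by have : 1 <= 2 ^+ l :> R; [rewrite exprn_ege1// ler1n|lra].
exact: (@expectation_max_emp _ _ _ _ _ Z_iid _ (grid (scale l)) f F V _ n n1 L1
  (size_grid_scale l) mF mf (fun u z _ => fF u z) FV).
Qed.

Lemma step_increment u v l z : `|u - v| <= 2 / (scale l)%:R ->
  `|(step l)^-1 * (f u z - f v z)| <= H z.
Proof.
move=> uv; rewrite normrM ger0_norm ?invr_ge0 ?powR_ge0//.
rewrite mulrC ler_pdivrMr//; apply: le_trans (fH u v z) _; rewrite mulrC.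
rewrite ler_wpM2l//; apply: ge0_ler_powR => //; first exact: ltW.
by rewrite nnegrE divr_ge0.

Qed.

Lemma emp_step n u v l x :
  emp Z n (fun z => (step l)^-1 * (f u z - f v z)) x =
  (step l)^-1 * (emp Z n (f u) x - emp Z n (f v) x).
Proof.
rewrite empZ ?empB//.
by under eq_fun do rewrite EFinB; exact: integrableB.
Qed.

Let m_step u v l : measurable_fun setT (fun z => (step l)^-1 * (f u z - f v z)).
Proof. by apply: measurable_funM => //; exact: measurable_funB. Qed.

(** The maximal inequality for the increments divided by [step l], which have
    the envelope [H]. *)
Lemma bound_on_links n l : (1 <= n)%N ->
  exists2 D : T -> R, mean_bound P D (C * Num.sqrt (12 * 2 ^+ l))
    & forall u v x, (u, v) \in links l ->
        `|emp Z n (f u) x - emp Z n (f v) x| <= step l * D x.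
Proof.
move=> n1.
have L1 : 1 <= 12 * 2 ^+ l :> R.
  have : 1 <= 2 ^+ l :> R by rewrite exprn_ege1// ler1n.
  lra.
have [|p z pl||D Db DP] := @expectation_max_emp _ _ _ _ _ Z_iid _ (links l)
   (fun p z => (step l)^-1 * (f p.1 z - f p.2 z)) H V _ n n1 L1 (size_links l) mH.
- by move=> p; exact: m_step.
- by apply: step_increment; move: pl; rewrite mem_filter => /andP[].
- exact: HV.
exists D => // u v x uv; rewrite mulrC -ler_pdivrMr//.
have := DP _ x uv; rewrite /= emp_step normrM.
by rewrite ger0_norm ?invr_ge0 ?powR_ge0// mulrC.
Qed.

(** Unlike [bound_on_links], for all pairs of close reals at once. *)
Lemma bound_near n l : (1 <= n)%N ->
  exists2 D : T -> R, mean_bound P D (2 * Num.sqrt n%:R * (1 + V))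
    & forall u v x, `|u - v| <= 2 / (scale l)%:R ->
        `|emp Z n (f u) x - emp Z n (f v) x| <= step l * D x.
Proof.
move=> n1.
have [D Db DP] := crude_bound Z_iid n1 mH H0 (integral_le_square mH H0 HV).
exists D => // u v x uv; rewrite mulrC -ler_pdivrMr//.
have := DP _ (m_step u v l) (fun z => step_increment z uv) x.
rewrite emp_step normrM.
by rewrite ger0_norm ?invr_ge0 ?powR_ge0// mulrC.
Qed.

(** The chaining argument for one sample path [G], with the majorants as given
    constants.  The last two summands stop the chain: [Dn] handles the step from
    u to the grid of level n, and [DF] the points u beyond the n-th scale. *)
Lemma chain_bound n (G : R -> R) (D1 D2 : nat -> R) (Dn DF : R) u :
  (forall l v, v \in grid (scale l) -> `|G v| <= D1 l) ->
  (forall l v w, (v, w) \in links l -> `|G v - G w| <= step l * D2 l) ->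
  (forall v w, `|v - w| <= 2 / (scale n)%:R -> `|G v - G w| <= step n * Dn) ->
  `|G u| <= DF -> (forall l, 0 <= D1 l) -> (forall l, 0 <= D2 l) ->
  0 <= Dn -> 0 <= DF ->
  `|G u| * weight delta u <=
    \sum_(0 <= l < n.+1) scale_weight delta l * D1 l +
    \sum_(0 <= l < n) step l * D2 l + step n * Dn +
    scale_weight delta n.+1 * DF.
Proof.
move=> GD1 GD2 GDn GDF D10 D20 Dn0 DF0.
have w0 l : 0 <= scale_weight delta l by exact: powR_ge0.
have t10 a b : 0 <= \sum_(a <= l < b) scale_weight delta l * D1 l.
  by apply: sumr_ge0 => l _; rewrite mulr_ge0.
have t20 a b : 0 <= \sum_(a <= l < b) step l * D2 l.
  by apply: sumr_ge0 => l _; rewrite mulr_ge0// ltW.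
have t30 : 0 <= step n * Dn by rewrite mulr_ge0// ltW.
have t40 : 0 <= scale_weight delta n.+1 * DF by rewrite mulr_ge0.
have [un|un] := leP `|u| (scale n)%:R; last first.
  rewrite -[leLHS]add0r lerD ?addr_ge0//.
  rewrite mulrC ler_pM ?weight_ge0//; apply: weight_le_scale => // m [<-].
  exact: ltW.
have ex : exists l, `|u| <= (scale l)%:R by exists n.
(* The first scale that reaches |u| is where w(u) is comparable to
   [scale_weight], which pays for the entropy of that grid. *)
case: (ex_minnP ex) => l0 ul0 minl0.
have l0n : (l0 <= n)%N by exact: minl0.
have wl0 : weight delta u <= scale_weight delta l0.
  apply: weight_le_scale => // m l0m; rewrite leNgt; apply/negP => /ltW/minl0.
  by rewrite l0m ltnn.
have /choice[pi piP] : forall l, exists v, (l0 <= l)%N ->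
    v \in grid (scale l) /\ `|u - v| <= (scale l)%:R^-1.
  move=> l; case: (leqP l0 l) => [ll|_]; last by exists 0.
  have [|v v1 v2] := @grid_approx R (scale l) u (scale_gt0 l).
    by apply: le_trans ul0 _; exact: ler_scale.
  by exists v.
have s0 l : 0 < (scale l)%:R^-1 :> R by rewrite invr_gt0 ltr0n scale_gt0.
have GuE : G u = (G u - G (pi n)) +
    \sum_(l0 <= l < n) (G (pi l.+1) - G (pi l)) + G (pi l0).
  by rewrite telescope_sumr//; ring.
have h1 : `|G u - G (pi n)| <= step n * Dn.
  apply: GDn; have [_ h] := piP n l0n; apply: le_trans h _.
  by have := s0 n; lra.
have h2 : `|\sum_(l0 <= l < n) (G (pi l.+1) - G (pi l))|
    <= \sum_(0 <= l < n) step l * D2 l.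
  apply: (@le_trans _ _ (\sum_(l0 <= l < n) step l * D2 l)); last first.
    by rewrite (big_cat_nat (n := l0) (m := 0))//= lerDr.
  apply: le_trans (ler_norm_sum _ _ _) _.
  rewrite big_nat [leRHS]big_nat; apply: ler_sum => l /andP[l0l ln].
  apply: GD2.
  have [pl ul] := piP l l0l; have [pl1 ul1] := piP l.+1 (leqW l0l).
  rewrite mem_filter allpairs_f// andbT /=.
  have -> : pi l.+1 - pi l = (u - pi l) - (u - pi l.+1) by ring.
  apply: le_trans (ler_normB _ _) _.
  have : (scale l.+1)%:R^-1 <= (scale l)%:R^-1 :> R.
    by rewrite lef_pV2 ?posrE ?ltr0n ?scale_gt0// ler_scale.
  lra.
have h3 : `|G (pi l0)| * scale_weight delta l0 <=
    \sum_(0 <= l < n.+1) scale_weight delta l * D1 l.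
  rewrite (big_cat_nat (n := l0) (m := 0))//=; last exact: leqW.
  rewrite (big_ltn (m := l0))// mulrC.
  have [pl _] := piP l0 (leqnn _).
  rewrite -[leLHS]add0r lerD// -[leLHS]addr0 lerD// ler_wpM2l//.
  exact: GD1.
have wu := weight_ge0 delta u; have wu1 := weight_le1 u delta_gt0.
apply: (@le_trans _ _ (`|G (pi l0)| * scale_weight delta l0 +
   (\sum_(0 <= l < n) step l * D2 l + step n * Dn))); last by rewrite addrA; lra.
rewrite GuE; apply: (@le_trans _ _ ((`|G (pi l0)| + (\sum_(0 <= l < n) step l * D2 l + step n * Dn)) *
   weight delta u)).
  rewrite ler_wpM2r//; apply: le_trans (ler_normD _ _) _.
  rewrite addrC lerD2l; apply: le_trans (ler_normD _ _) _.
  by rewrite addrC lerD.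
rewrite mulrDl lerD//; first by rewrite ler_wpM2l.
by rewrite ler_piMr// addr_ge0.
Qed.


Lemma sum_scale_weight_le m : \sum_(0 <= l < m) scale_weight delta l *
    (C * Num.sqrt (4 * 2 ^+ l)) <=
  C * (4 * 4 `^ delta) * (1 - 2 `^ (- delta))^-1.
Proof.
have C0 : 0 <= C by rewrite /C; have := V0; lra.
rewrite (eq_bigr (fun l => C * (4 * 4 `^ delta) * (2 `^ (- delta)) ^+ l)); last first.
  by move=> l _; rewrite mulrCA scale_weight_sqrt; ring.
rewrite -mulr_sumr ler_wpM2l ?geometric_sum_le ?powR_ge0//.
  by rewrite !mulr_ge0// powR_ge0.
rewrite powRN invf_lt1 ?powR_gt0//.
by rewrite -[ltLHS](powRr0 2) /powR gt_eqF// ltr_expR ltr_pM2r// ln_gt0// ltr1n.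
Qed.

Lemma sum_step_le m : \sum_(0 <= l < m) step l * (C * Num.sqrt (12 * 2 ^+ l)) <=
  C * (16 / alpha) * (1 - (Num.sqrt 2)^-1)^-1.
Proof.
have C0 : 0 <= C by rewrite /C; have := V0; lra.
have s2 : 0 < Num.sqrt 2 :> R by rewrite sqrtr_gt0.
have a0 : 0 < alpha^-1 by rewrite invr_gt0.
apply: (@le_trans _ _ (\sum_(0 <= l < m) C * (16 / alpha) * (Num.sqrt 2)^-1 ^+ l)).
  apply: ler_sum => l _.
  have e0 : 0 < 2 ^+ l :> R by exact: exprn_gt0.
  have h12 : Num.sqrt (12 * 2 ^+ l) <= 4 * Num.sqrt 2 ^+ l :> R.
    have p4 : 0 <= 4 * Num.sqrt 2 ^+ l :> R by rewrite mulr_ge0 ?exprn_ge0 ?sqrtr_ge0.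
    rewrite -[leRHS](ger0_norm p4) -sqrtr_sqr ler_wsqrtr//.
    rewrite exprMn -exprM mulnC exprM sqr_sqrtr//.
    lra.
  rewrite mulrCA -mulrA; apply: ler_wpM2l => //.
  apply: (@le_trans _ _ ((4 / alpha / 2 ^+ l) * (4 * Num.sqrt 2 ^+ l))).
    by apply: ler_pM; rewrite ?powR_ge0 ?sqrtr_ge0 ?scale_powR.
  have -> : 2 ^+ l = Num.sqrt 2 ^+ l * Num.sqrt 2 ^+ l :> R.
    by rewrite -exprMn -expr2 sqr_sqrtr.
  rewrite exprVn le_eqVlt; apply/orP; left; apply/eqP.
  by field; rewrite !gt_eqF// exprn_gt0.
rewrite -mulr_sumr ler_wpM2l ?geometric_sum_le ?invr_ge0 ?sqrtr_ge0//.
  by rewrite !mulr_ge0// ltW.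
rewrite invf_lt1// -[ltLHS]sqrtr1 ltr_sqrt//; lra.
Qed.

Lemma sqrt_nat_le n : Num.sqrt n%:R <= 2 ^+ n :> R.
Proof.
apply: (@le_trans _ _ n%:R).
  have [->|n0] := posnP n; first by rewrite sqrtr0.
  rewrite -[leRHS]sqr_sqrtr// expr2 ler_peMl ?sqrtr_ge0//.
  by rewrite -[leLHS]sqrtr1 ler_wsqrtr// ler1n.
by rewrite -natrX ler_nat ltnW// ltn_expl.
Qed.

(** The four summands of [chain_bound] have expectations bounded uniformly in n:
    two geometric series, and two remainders in which 2^n absorbs the factor
    sqrt n of [crude_bound]. *)
Lemma weighted_chaining : exists C0 : R, forall n, (1 <= n)%N ->
  exists2 D : T -> R, mean_bound P D C0 &
    forall u x, `|emp Z n (f u) x| * weight delta u <= D x.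
Proof.
pose C1 := C * (4 * 4 `^ delta) * (1 - 2 `^ (- delta))^-1.
pose C2 := C * (16 / alpha) * (1 - (Num.sqrt 2)^-1)^-1.
exists (C1 + C2 + 8 / alpha * (1 + V) + 8 * 4 `^ delta * (1 + V)) => n n1.
have VV := V0.
have /choice[D1 D1P] : forall l, exists D : T -> R,
    mean_bound P D (C * Num.sqrt (4 * 2 ^+ l)) /\
    forall u x, u \in grid (scale l) -> `|emp Z n (f u) x| <= D x.
  by move=> l; have [D] := bound_on_grid l n1; exists D.
have /choice[D2 D2P] : forall l, exists D : T -> R,
    mean_bound P D (C * Num.sqrt (12 * 2 ^+ l)) /\
    forall u v x, (u, v) \in links l ->
        `|emp Z n (f u) x - emp Z n (f v) x| <= step l * D x.
  by move=> l; have [D] := bound_on_links l n1; exists D.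
have [Dn Dnb DnP] := bound_near n n1.
have F0 z : 0 <= F z by exact: le_trans (fF 0 z).
have [DF DFb DFP] := crude_bound Z_iid n1 mF F0 (integral_le_square mF F0 FV).
exists (fun x => \sum_(0 <= l < n.+1) scale_weight delta l * D1 l x +
    \sum_(0 <= l < n) step l * D2 l x + step n * Dn x +
    scale_weight delta n.+1 * DF x).
  have sw0 l : 0 <= scale_weight delta l by exact: powR_ge0.
  apply: mean_boundD; [apply: mean_boundD; [apply: mean_boundD|]|].
  - apply: mean_bound_le (sum_scale_weight_le n.+1) _.
    apply: mean_bound_sum => l _; apply: mean_boundZ => //.
    by have [] := D1P l.
  - apply: mean_bound_le (sum_step_le n) _.
    apply: mean_bound_sum => l _; apply: mean_boundZ; first exact: ltW.
    by have [] := D2P l.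
  - apply: mean_bound_le (mean_boundZ (ltW (step_gt0 n)) Dnb).
    have e0 : 0 < 2 ^+ n :> R by exact: exprn_gt0.
    apply: (@le_trans _ _ ((4 / alpha / 2 ^+ n) * (2 * 2 ^+ n * (1 + V)))).
      apply: ler_pM; rewrite ?powR_ge0 ?scale_powR ?mulr_ge0 ?sqrtr_ge0//.
        by lra.
      by rewrite ler_wpM2r ?ler_wpM2l ?sqrt_nat_le//; lra.
    rewrite le_eqVlt; apply/orP; left; apply/eqP.
    by field; rewrite !gt_eqF.
  - apply: mean_bound_le (mean_boundZ (sw0 _) DFb).
    apply: (@le_trans _ _ (2 * (1 + V) *
        (scale_weight delta n.+1 * Num.sqrt (4 * 2 ^+ n.+1)))).
      rewrite [leLHS](_ : _ = 2 * (1 + V) *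
        (scale_weight delta n.+1 * Num.sqrt n%:R)); last by ring.
      rewrite ler_wpM2l//; first by rewrite mulr_ge0//; lra.
      rewrite ler_wpM2l// ler_wsqrtr//.
      apply: (@le_trans _ _ (2 ^+ n)); first by rewrite -natrX ler_nat ltnW// ltn_expl.
      have : 0 < 2 ^+ n :> R by exact: exprn_gt0.
      by rewrite exprS; lra.
    rewrite scale_weight_sqrt.
    have q1 : (2 `^ (- delta)) ^+ n.+1 <= 1 :> R.
      rewrite exprn_ile1 ?powR_ge0// -[leRHS](powRr0 2) ler_powR ?ler1n// oppr_le0 ltW//.
    rewrite [leLHS](_ : _ = 8 * 4 `^ delta * (1 + V) * (2 `^ (- delta)) ^+ n.+1); last by ring.
    by rewrite ler_piMr// !mulr_ge0 ?powR_ge0//; lra.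
move=> u x; apply: (@chain_bound n (fun u => emp Z n (f u) x)).
- by move=> l v vl; exact: (D1P l).2.
- by move=> l v w vw; exact: (D2P l).2.
- by move=> v w; exact: DnP.
- by apply: DFP.
- by move=> l; have [[]] := D1P l.
- by move=> l; have [[]] := D2P l.
- by have [] := Dnb.
- by have [] := DFb.
Qed.

End chaining.

(** * Derivatives of the characteristic function process *)

Section complex_valued.
Context {R : realType}.
Local Open Scope complex_scope.

Lemma Rcomplex_norm_le (x y : R) :
  `|(x +i* y : Rcomplex R)| <= `|x| + `|y|.
Proof.
rewrite [leLHS](_ : _ = Num.sqrt (x ^+ 2 + y ^+ 2)); last by rewrite /Num.norm.
have h : 0 <= `|x| + `|y| by rewrite addr_ge0.
rewrite -[leRHS](ger0_norm h) -sqrtr_sqr ler_wsqrtr//.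
rewrite sqrrD !real_normK ?num_real//.
have : 0 <= `|x| * `|y| by rewrite mulr_ge0.
lra.
Qed.


Lemma derive1_Rcomplex (a b : R -> R) (u da db : R) :
  is_derive u 1 a da -> is_derive u 1 b db ->
  derive1 (fun v => a v +i* b v : Rcomplex R) u = da +i* db.
Proof.
move=> ha hb.
have quot (f : R -> R) df : is_derive u 1 f df ->
    h^-1 *: (f (h + u) - f u) @[h --> 0^'] --> df.
  move=> [ef <-]; have := ef; rewrite /derivable /derive.
  by under eq_fun do rewrite /= /GRing.scale/= mulr1.
apply: cvg_lim => //; apply/cvgrPdist_lt => e e0.
have e2 : 0 < e / 2 by rewrite divr_gt0.
have /cvgrPdist_lt/(_ _ e2) ca := quot _ _ ha.
have /cvgrPdist_lt/(_ _ e2) cb := quot _ _ hb.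
near=> h.
have ha1 : `|da - h^-1 *: (a (h + u) - a u)| < e / 2 by near: h; exact: ca.
have hb1 : `|db - h^-1 *: (b (h + u) - b u)| < e / 2 by near: h; exact: cb.
rewrite [X in `|X|](_ : _ = (da - h^-1 *: (a (h + u) - a u)) +i*
                            (db - h^-1 *: (b (h + u) - b u)))//.
apply: le_lt_trans (Rcomplex_norm_le _ _) _.
by rewrite [ltRHS]splitr ltrD.
Unshelve. all: by end_near. Qed.

End complex_valued.
Section cosine_family.
Context {R : realType}.

(** The j-th derivative in [u] of cos(u z + theta); the shift by j quarter turns
    keeps the family closed under differentiation, and sin is the case
    theta = - pi/2. *)
Definition cosmono (j : nat) (theta u z : R) : R :=
  z ^+ j * cos (u * z + theta + j%:R * (pi / 2)).


Lemma is_derive_cosmono j theta z (u : R) :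
  is_derive u 1 (fun u => cosmono j theta u z) (cosmono j.+1 theta u z).
Proof.
pose c := theta + j%:R * (pi / 2).
have h1 : is_derive u 1 ((z \*: (id : R -> R)) + cst c) z.
  by apply: is_derive_eq; rewrite addr0 /GRing.scale/= mulr1.
have h3 := is_deriveZ (z ^+ j) (@is_derive1_comp _ cos (z \*: (id : R -> R) + cst c) u _ _ (is_derive_cos _) h1).
have -> : (fun u => cosmono j theta u z) =
    z ^+ j \*: (cos \o ((z \*: (id : R -> R)) + cst c)).
  by apply/funext => v; rewrite /cosmono /= -addrA [v * z]mulrC.
apply: is_derive_eq; rewrite /cosmono -natr1 mulrDl mul1r [u * z + theta + (_ + _)]addrA cosDpihalf.
rewrite exprSr /GRing.scale/= fctE /= (_ : z * u + c = u * z + theta + j%:R * (pi / 2)).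
  by ring.
by rewrite /c; ring.
Qed.

End cosine_family.
Section cosine_family_bounds.
Context {R : realType}.

Lemma measurable_cosmono j theta (u : R) : measurable_fun setT (cosmono j theta u).
Proof.
apply: measurable_funM; first exact: measurable_funX.
apply: (measurableT_comp (f := @cos R)).
  exact: continuous_measurable_fun (@continuous_cos R).
by do 2 apply: measurable_funD => //; exact: measurable_funM.
Qed.

Lemma normr_cosmono_le j theta (u z : R) : `|cosmono j theta u z| <= `|z| ^+ j.
Proof.
rewrite /cosmono normrM normrX ler_piMr ?exprn_ge0// ler_norml.
by rewrite cos_geN1 cos_le1.
Qed.

End cosine_family_bounds.

Lemma is_derive_big_sum (R : realType) (I : Type) (s : seq I) (h : I -> R -> R)
    (dh : I -> R) (u : R) :
  (forall i, is_derive u 1 (h i) (dh i)) ->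
  is_derive u 1 (fun v => \sum_(i <- s) h i v) (\sum_(i <- s) dh i).
Proof.
move=> hd; elim: s => [|a s IH].
  rewrite big_nil (_ : (fun v => _) = cst 0); first exact: is_derive_cst.
  by apply/funext => v; rewrite big_nil.
rewrite big_cons (_ : (fun v => _) = h a + (fun v => \sum_(i <- s) h i v)).
  exact: is_deriveD.
by apply/funext => v; rewrite big_cons.
Qed.

Section derivatives.
Context {d : measure_display} {T : measurableType d} {R : realType}.
Variable P : probability T R.
Variable Z : nat -> {RV P >-> R}.

Let abs_moment_le (m : R) (j : nat) :=
  (\int[P]_x (`|Z 1%N x| ^+ j)%:E <= m%:E)%E.

Let mnormX j : measurable_fun setT (fun z : R => `|z| ^+ j).
Proof. by apply: measurable_funX; exact: normr_measurable. Qed.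

Lemma integrable_cosmono (m : R) j theta u : abs_moment_le m j ->
  P.-integrable setT (fun x => (cosmono j theta u (Z 1%N x))%:E).
Proof.
move=> mj; apply: (@dom_integrable _ _ _ _ _ _ (fun z => `|z| ^+ j) m) => //.
- exact: measurable_cosmono.
- by move=> z; exact: normr_cosmono_le.
Qed.

(** Differentiation under the expectation: the derivative in [v] is dominated by
    |Z_1|^(j+1) uniformly in [v]. *)
Lemma is_derive_mean_cosmono (m : R) j theta (u : R) :
  abs_moment_le m j -> abs_moment_le m j.+1 ->
  is_derive u 1 (fun v => mean Z (cosmono j theta v)) (mean Z (cosmono j.+1 theta u)).
Proof.
move=> mj mj1.
pose f v x := cosmono j theta v (Z 1%N x).
have partialE v x : partial1of2 f v x = cosmono j.+1 theta v (Z 1%N x).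
  rewrite /partial1of2 derive1E.
  by have [_ ->] := is_derive_cosmono j theta (Z 1%N x) v.
have uI : `]u - 1, u + 1[%classic u by rewrite /= in_itv/=; apply/andP; split; lra.
have fint v : `]u - 1, u + 1[%classic v -> P.-integrable setT (EFin \o f v).
  by move=> _; exact: integrable_cosmono mj.
have fder v x : `]u - 1, u + 1[%classic v -> setT x -> derivable (f ^~ x) v 1.
  by move=> _ _; have [] := is_derive_cosmono j theta (Z 1%N x) v.
have G0 x : 0 <= `|Z 1%N x| ^+ j.+1 by exact: exprn_ge0.
have Gint : P.-integrable setT (EFin \o (fun x => `|Z 1%N x| ^+ j.+1)).
  apply: (@dom_integrable _ _ _ _ Z (fun z => `|z| ^+ j.+1) (fun z => `|z| ^+ j.+1) m) => //.
  by move=> z; rewrite normrX normr_id.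
have Gub v x : `]u - 1, u + 1[%classic v -> setT x ->
    `|partial1of2 f v x| <= `|Z 1%N x| ^+ j.+1.
  by move=> _ _; rewrite partialE; exact: normr_cosmono_le.
apply: DeriveDef.
  exact: (derivable_under_integral measurableT uI fint fder G0 Gint Gub).
rewrite -derive1E.
have -> := differentiation_under_integral measurableT uI fint fder G0 Gint Gub.
by apply: eq_Rintegral => x _; rewrite partialE.
Qed.

Lemma is_derive_emp_cosmono (m : R) n j theta x (u : R) :
  abs_moment_le m j -> abs_moment_le m j.+1 ->
  is_derive u 1 (fun v => emp Z n (cosmono j theta v) x)
                (emp Z n (cosmono j.+1 theta u) x).
Proof.
move=> mj mj1; rewrite /emp.
pose h t v := cosmono j theta v (Z t x) - mean Z (cosmono j theta v).
pose dh t := cosmono j.+1 theta u (Z t x) - mean Z (cosmono j.+1 theta u).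
apply: (@is_deriveZ _ _ _ (fun v => \sum_(1 <= t < n.+1) h t v)).
apply: is_derive_big_sum => t.
apply: (@is_deriveB _ _ _ (fun v => cosmono j theta v (Z t x))
  (fun v => mean Z (cosmono j theta v))).
  exact: is_derive_cosmono.
exact: is_derive_mean_cosmono mj mj1.
Qed.

Local Open Scope complex_scope.

Lemma char_processE n x u : char_process P Z n x u =
  emp Z n (cosmono 0 0 u) x +i* emp Z n (cosmono 0 (- (pi / 2)) u) x.
Proof.
have sumE (I : Type) (s : seq I) (a b : I -> R) :
    \sum_(i <- s) (a i +i* b i : Rcomplex R) =
    (\sum_(i <- s) a i) +i* (\sum_(i <- s) b i).
  by elim: s => [|i s IH]; rewrite ?big_nil// !big_cons IH.
have c0 v z : cosmono 0 0 v z = cos (v * z) :> R.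
  by rewrite /cosmono expr0 mul1r mul0r !addr0.
have s0 v z : cosmono 0 (- (pi / 2)) v z = sin (v * z) :> R.
  by rewrite /cosmono expr0 mul1r mul0r addr0 cosBpihalf.
rewrite /char_process /emp.
rewrite [X in _ *: X](_ : _ =
    (\sum_(1 <= t < n.+1) (cosmono 0 0 u (Z t x) - mean Z (cosmono 0 0 u))) +i*
    (\sum_(1 <= t < n.+1) (cosmono 0 (- (pi / 2)) u (Z t x) -
                           mean Z (cosmono 0 (- (pi / 2)) u))))//.
rewrite -sumE; apply: eq_bigr => t _.
rewrite /Cexpectation unlock c0 s0 /mean.
congr (_ - (_ +i* _)).
  by congr fine; apply: eq_integral => y _; rewrite c0 mulrC.
by congr fine; apply: eq_integral => y _; rewrite s0 mulrC.
Qed.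

Lemma derive1n_char_process (m : R) k n x :
  (forall j, (j <= k)%N -> abs_moment_le m j) ->
  derive1n k (char_process P Z n x) =
  fun u => emp Z n (cosmono k 0 u) x +i* emp Z n (cosmono k (- (pi / 2)) u) x.
Proof.
elim: k => [_|k IH mk]; first by apply/funext => u; exact: char_processE.
rewrite derive1nS IH; last by move=> j jk; apply: mk; exact: leqW.
apply/funext => u; apply: derive1_Rcomplex;
  by apply: (@is_derive_emp_cosmono m); apply: mk.
Qed.

End derivatives.

(** * The weighted bound *)

Lemma cos_lipschitz (R : realType) (a b : R) : `|cos a - cos b| <= `|a - b|.
Proof.
wlog ab : a b / a < b => [h|].
  have [ab|ab|->] := ltgtP a b; first exact: h.
    by rewrite distrC [leRHS]distrC; exact: h.
  by rewrite !subrr.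
have [c _ e] := @MVT _ (@cos R) (fun x => - sin x) _ _ ab
  (fun x _ => is_derive_cos x) (continuous_subspaceT (@continuous_cos R)).
rewrite distrC [leRHS]distrC e normrM normrN ler_piMl//.
by rewrite ler_norml sin_geN1 sin_le1.
Qed.

(** Interpolation between the Lipschitz bound, used when |a - b| <= 1, and the
    trivial bound 2. *)
Lemma cos_hoelder (R : realType) (alpha a b : R) : 0 < alpha -> alpha <= 1 ->
  `|cos a - cos b| <= 2 * `|a - b| `^ alpha.
Proof.
move=> a0 a1; have [ab|ab] := leP `|a - b| 1.
  apply: le_trans (cos_lipschitz a b) _.
  have [->|n0] := eqVneq `|a - b| 0; first by rewrite mulr_ge0// powR_ge0.
  have p : 0 < `|a - b| by rewrite lt_def n0 normr_ge0.
  have := @ger1_powR _ `|a - b| alpha; rewrite p ab => /(_ isT a1).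
  have := powR_ge0 `|a - b| alpha; lra.
have h : 1 <= `|a - b| `^ alpha.
  by rewrite -(powRr0 `|a - b|) ler_powR// ltW.
have := cos_le1 a; have := cos_le1 b; have := cos_geN1 a; have := cos_geN1 b.
rewrite ler_norml => *; apply/andP; split; lra.
Qed.

Lemma powR_le1D (R : realType) (y q p : R) : 0 <= y -> 0 <= q -> q <= p ->
  y `^ q <= 1 + y `^ p.
Proof.
move=> y0 q0 qp; have [y1|y1] := leP y 1.
  apply: (@le_trans _ _ 1); last by rewrite lerDl powR_ge0.
  apply: (@le_trans _ _ (1 `^ q)); last by rewrite powR1.
  by rewrite ge0_ler_powR ?nnegrE.
by apply: (@le_trans _ _ (y `^ p)); [rewrite ler_powR// ltW|rewrite lerDr].
Qed.

Theorem theorem4p1 (d : measure_display) (T : measurableType d) (R : realType)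
    (P : probability T R) (Z : nat -> {RV P >-> R}) (k : nat)
    (gamma delta : R)
    (gamma_gt0 : 0 < gamma) (delta_gt0 : 0 < delta)
    (Z_iid : iid P Z)
    (Z_moment :
       ('E_P[fun x => (`|Z 1%N x| `^ (2 * k%:R + gamma))%R] < +oo)%E) :
  (ereal_sup
     [set \int[P]_x weighted_sup_norm (weight delta)
                      (derive1n k (char_process P Z n x))
       | n in [set n : nat | (1 <= n)%N]] < +oo)%E.
Proof.
pose p := 2 * k%:R + gamma.
have k0 : 0 <= k%:R :> R by exact: ler0n.
(* The Hoelder exponent: H below is square integrable because
   2 (k + alpha) <= 2 k + gamma. *)
pose alpha := Num.min 1 (gamma / 2).
have al0 : 0 < alpha by rewrite lt_min ltr01 divr_gt0.
have al1 : alpha <= 1 by rewrite ge_min lexx.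
have alg : alpha <= gamma / 2 by rewrite ge_min lexx orbT.
pose m := fine (\int[P]_x (`|Z 1%N x| `^ p)%:E)%E.
have int0 : (0 <= \int[P]_x (`|Z 1%N x| `^ p)%:E)%E.
  by apply: integral_ge0 => x _; rewrite lee_fin powR_ge0.
have intm : (\int[P]_x (`|Z 1%N x| `^ p)%:E = m%:E)%E.
  by rewrite /m fineK// ge0_fin_numE//; move: Z_moment; rewrite unlock.
have m0 : 0 <= m by exact: fine_ge0.
have mnorm : measurable_fun setT (fun z : R => `|z|) by exact: normr_measurable.
have mpow q : measurable_fun setT (fun z : R => `|z| `^ q).
  by apply: (measurableT_comp (measurable_powR q)).
have moment_le (g : R -> R) : (forall z, 0 <= g z <= 4 * (1 + `|z| `^ p)) ->
    (\int[P]_x (g (Z 1%N x))%:E <= (4 * (1 + m))%:E)%E.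
  move=> g0; apply: (@le_trans _ _ (\int[P]_x (4 * (1 + `|Z 1%N x| `^ p))%:E)%E).
    by apply: ge0_le_integral_nomeas => x; rewrite lee_fin; have /andP[] := g0 (Z 1%N x).
  have mp : measurable_fun setT (fun x => `|Z 1%N x| `^ p).
    by apply: (measurableT_comp (mpow p)).
  have [_ _] : mean_bound P (fun x => 4 * (1 + `|Z 1%N x| `^ p)) (4 * (1 + m)).
    apply: mean_boundZ => //; apply: mean_boundD; first exact: mean_bound_cst.
    by split => //; rewrite ?intm// => x; exact: powR_ge0.
  by [].
have abs_moment j : (j <= k)%N ->
    (\int[P]_x (`|Z 1%N x| ^+ j)%:E <= (4 * (1 + m))%:E)%E.
  move=> jk; apply: (moment_le (fun z => `|z| ^+ j)) => z; rewrite exprn_ge0//=.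
  rewrite -powR_mulrn//; apply: (@le_trans _ _ (1 + `|z| `^ p)).
    apply: powR_le1D => //; rewrite /p.
    have : j%:R <= k%:R :> R by rewrite ler_nat.
    by lra.
  by have := powR_ge0 `|z| p; lra.
pose F (z : R) := `|z| ^+ k.
pose H (z : R) := 2 * (`|z| ^+ k * `|z| `^ alpha).
have mF : measurable_fun setT F by exact: measurable_funX.
have mH : measurable_fun setT H by do 2 apply: measurable_funM => //.
have H0 z : 0 <= H z by rewrite !mulr_ge0 ?exprn_ge0 ?powR_ge0.
have FV : (\int[P]_x (F (Z 1%N x) ^+ 2)%:E <= (4 * (1 + m))%:E)%E.
  apply: (moment_le (fun z => F z ^+ 2)) => z; rewrite sqr_ge0/= /F -exprM.
  rewrite -powR_mulrn//; apply: (@le_trans _ _ (1 + `|z| `^ p)).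
    by apply: powR_le1D => //; rewrite /p natrM; lra.
  by have := powR_ge0 `|z| p; lra.
have HV : (\int[P]_x (H (Z 1%N x) ^+ 2)%:E <= (4 * (1 + m))%:E)%E.
  apply: (moment_le (fun z => H z ^+ 2)) => z; rewrite sqr_ge0/= /H exprMn.
  rewrite -natrX ler_wpM2l//.
  rewrite -(powR_mulrn k (normr_ge0 z)) -powRD; last by rewrite gt_eqF// ltr_wpDl.
  rewrite -powR_mulrn ?powR_ge0// -powRrM; apply: powR_le1D => //.
    by rewrite mulr_ge0// addr_ge0// ltW.
  by rewrite /p; lra.
have fF theta u z : `|cosmono k theta u z| <= F z by exact: normr_cosmono_le.
have fH theta u v z : `|cosmono k theta u z - cosmono k theta v z| <=
    `|u - v| `^ alpha * H z.
  rewrite /cosmono -mulrBr normrM normrX /H.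
  rewrite [leRHS](_ : _ = `|z| ^+ k * (2 * (`|u - v| `^ alpha * `|z| `^ alpha))); last by ring.
  rewrite ler_wpM2l ?exprn_ge0// -powRM// -normrM.
  apply: le_trans (cos_hoelder _ _ al0 al1) _.
  by rewrite le_eqVlt; apply/orP; left; apply/eqP; congr (_ * `|_| `^ _); ring.
have chain theta := weighted_chaining Z_iid al0 al1 delta_gt0
  (measurable_cosmono k theta) mF mH (fF theta) H0 (fH theta) FV HV.
have [C0 hC0] := chain 0.
have [C1 hC1] := chain (- (pi / 2)).
apply: (@le_lt_trans _ _ (C0 + C1)%:E); last exact: ltry.
apply: ge_ereal_sup => _ [n /= n1 <-].
have [D0 D0b D0P] := hC0 n n1.
have [D1 D1b D1P] := hC1 n n1.
have [_ _] := mean_boundD D0b D1b; apply: le_trans.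
apply: ge0_le_integral_nomeas => x; rewrite (derive1n_char_process _ _ abs_moment).
  apply: le_trans (ereal_sup_ubound _); last by exists 0.
  by rewrite lee_fin mulr_ge0// powR_ge0.
apply: ge_ereal_sup => _ [u _ <-]; rewrite lee_fin.
apply: (@le_trans _ _ ((`|emp Z n (cosmono k 0 u) x| +
  `|emp Z n (cosmono k (- (pi / 2)) u) x|) * weight delta u)).
  by rewrite ler_wpM2r ?weight_ge0// Rcomplex_norm_le.
by rewrite mulrDl lerD.
Qed.
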